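(* Let $H=(D,A,\rightarrow,\le,\sim)$ be the navigation history with documents $D=\{0,1,2,3,4\}$, active documents $A=\{0,1,2\}$, child relationship consisting exactly of $0\rightarrow 1$, $0\rightarrow 2$, $0\rightarrow 3$, $0\rightarrow 4$, chronological order $0<1<2<3<4$, and same-session equivalence classes $\{0\},\{1,3\},\{2,4\}$. For $B\subseteq D$ write $H[B]$ for $(D,B,\rightarrow,\le,\sim)$. Then $H$ traverses the history by $1$ to $H[\{0,2,3\}]$, which traverses the history by $1$ to $H[\{0,3,4\}]$, but $H$ traverses the history by $2$ to $H[\{0,1,4\}]\neq H[\{0,3,4\}]$. Consequently $H$ does not satisfy the fundamental property of traversal.
   Context: A directed graph $(V,\rightarrow)$ is a forest if there is no $v$ with $v\rightarrow^+ v$ (where $\rightarrow^+$ is the transitive closure) and every vertex has at most one parent (if $v\rightarrow v'$ and $v''\rightarrow v'$ then $v=v''$). A navigation history $H=(D,A,\rightarrow,\le,\sim)$ consists of: a finite set $D$ (documents); a subset $A\subseteq D$ (active documents); a forest $(D,\rightarrow)$ (child relationship); a total order $(D,\le)$ (chronological order), with strict part $<$; and an equivalence relation $\sim$ on $D$ (same-session equivalence); such that: - for every $d\in D$ there is a unique $d'\in A$ with $d\sim d'$; - whenever $d\rightarrow e$ and $e\sim e'$, also $d\rightarrow e'$; - whenever $d\rightarrow e$, also $d\le e$. Write $d\lesssim e$ when $d\sim e$ and $d<e$ (a strict relation). Let $d_0$ denote the unique active root document (an active document with no parent). Write $d\twoheadrightarrow e$ when $d\rightarrow e$ and $e\in A$.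 The set of fully active documents is $FA=\{d\mid d_0\twoheadrightarrow^* d\}$, where $\twoheadrightarrow^*$ is the reflexive transitive closure. In this (specification-aligned, unpatched) model, the joint session future of $H$ is $\{e\mid \exists d\in FA,\ d\lesssim e\}$ and the joint session past is $\{e\mid\exists d\in FA,\ e\lesssim d\}$. For $d\in D$, traversing the history to $d$ in $H$ yields $(D,A',\rightarrow,\le,\sim)$, where $e\in A'$ if and only if ($e\in A$ and $d\not\sim e$) or $e=d$. Traversal by an integer in this model (a partial operation, expressed as a relation): - For $n\ge1$, $H$ traverses the history by $+n$ to $H'$ when the joint session future of $H$, listed in increasing chronological order, is $d_1<\cdots<d_n<\cdots$ (at least $n$ elements), and traversing the history to $d_n$ in $H$ yields $H'$. - For $n\ge1$, $H$ traverses the history by $-n$ to $H'$ when the joint session past of $H$, listed in decreasing chronological order, is $d_1>\cdots>d_n>\cdots$ (at least $n$ elements), and traversing the history to $d_n$ in $H$ yields $H'$. - $H$ traverses the history by $0$ to $H'$ when $H=H'$. $H$ satisfies the fundamental property of traversal if, for all integers $\delta,\delta'$ and all $H',H''$, whenever $H$ traverses the history by $\delta$ to $H'$ and $H'$ traverses the history by $\delta'$ to $H''$, then $H$ traverses the history by $\delta+\delta'$ to $H''$. *)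

(* Defs.v *)
From mathcomp Require Import all_boot all_order all_algebra.
From Stdlib Require Import Relation_Operators.

Set Implicit Arguments.
Unset Strict Implicit.
Unset Printing Implicit Defensive.

Definition is_forest (V : Type) (e : rel V) : Prop :=
  (forall v, ~ clos_trans V e v v) /\
  (forall v v' v'', e v v' -> e v'' v' -> v = v'').

(* The bare data (D, A, ->, <=, ~); the axioms are in [navigation_history].
   Traversal never changes the set of documents, so D is a parameter. *)
Record history (D : finType) := History {
  active : {set D};
  child  : rel D;
  chron  : rel D;
  sim    : rel D
}.

Section NavigationHistory.
Variable D : finType.
Implicit Types (H : history D) (d e : D).

Definition navigation_history H : Prop :=
  [/\ is_forest (child H),
      [/\ reflexive (chron H), antisymmetric (chron H),
          transitive (chron H) & total (chron H)],
      [/\ reflexive (sim H), symmetric (sim H) & transitive (sim H)]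
    & [/\ forall d, exists! d', d' \in active H /\ sim H d d',
          forall d e e', child H d e -> sim H e e' -> child H d e'
        & forall d e, child H d e -> chron H d e]].

Definition with_active H (B : {set D}) : history D :=
  History B (child H) (chron H) (sim H).

Definition before H : rel D := [rel d e | chron H d e && (d != e)].

Definition session_before H : rel D := [rel d e | sim H d e && before H d e].

Definition active_root H d : bool :=
  (d \in active H) && [forall p, ~~ child H p d].

Definition unique_active_root H d0 : bool :=
  active_root H d0 && [forall r, active_root H r ==> (r == d0)].

Definition active_child H : rel D := [rel d e | child H d e && (e \in active H)].

(* The axioms do not force the active root to be unique; when it is not, d_0
   is undefined and this set is empty. *)
Definition fully_active H : {set D} :=
  [set d | [exists d0, unique_active_root H d0
                       && connect (active_child H) d0 d]].

Definition joint_session_future H : {set D} :=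
  [set e | [exists d in fully_active H, session_before H d e]].

Definition joint_session_past H : {set D} :=
  [set e | [exists d in fully_active H, session_before H e d]].

Definition traverse_to H d : history D :=
  with_active H [set e | (e \in active H) && ~~ sim H d e || (e == d)].

Definition future_list H : seq D :=
  sort (chron H) (enum (joint_session_future H)).

Definition past_list H : seq D :=
  sort (fun d e => chron H e d) (enum (joint_session_past H)).

(* Lists are indexed from 0, so d_(n+1) is entry n; [Negz n] is -(n+1). *)
Definition traverses_by H (delta : int) (H' : history D) : Prop :=
  match delta with
  | Posz 0    => H = H'
  | Posz n.+1 => exists2 d, onth (future_list H) n = Some d
                          & traverse_to H d = H'
  | Negz n    => exists2 d, onth (past_list H) n = Some d
                          & traverse_to H d = H'
  end.

Definition fundamental_property H : Prop :=
  forall (delta delta' : int) (H' H'' : history D),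
    navigation_history H' -> navigation_history H'' ->
    traverses_by H delta H' -> traverses_by H' delta' H'' ->
    traverses_by H (delta + delta')%R H''.

End NavigationHistory.

Definition docs (s : seq nat) : {set 'I_5} := [set d : 'I_5 | val d \in s].

Definition example_history : history 'I_5 := {|
  active := docs [:: 0; 1; 2];
  child  := fun d e =>
    (val d, val e) \in [:: (0, 1); (0, 2); (0, 3); (0, 4)];
  chron  := fun d e => val d <= val e;
  sim    := fun d e =>
    has (fun C => (val d \in C) && (val e \in C))
        [:: [:: 0]; [:: 1; 3]; [:: 2; 4]]
|}.

(* Main.v *)
Require Import Defs.
From mathcomp Require Import all_boot all_order all_algebra.
From Stdlib Require Import Relation_Operators.

(** As every document other than 0 is a child of 0, whenever 0 is active the
fully active documents are just the active ones, so both joint session futures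
can be computed: [3, 4] for active set {0, 1, 2} but only [4] for {0, 2, 3},
because traversing to 3 deactivates 1 without touching the session {2, 4}.
Traversal by a given integer is deterministic, hence the failure for 1 + 1. *)

Lemma traverses_by_functional (D : finType) (H H' H'' : history D) (delta : int) :
  traverses_by H delta H' -> traverses_by H delta H'' -> H' = H''.
Proof.
case: delta => [[|n]|n] /=; first by move=> -> .
- by move=> [d dn <-] [e]; rewrite dn => -[<-] <-.
- by move=> [d dn <-] [e]; rewrite dn => -[<-] <-.
Qed.

(** Membership is compared at the five numbers 0 to 4 only, so equality and inequality of concrete
    active sets are settled by evaluation. *)
Lemma docs_eqP (s t : seq nat) :
  reflect (docs s = docs t)
          (all (fun n => (n \in s) == (n \in t)) (iota 0 5)).
Proof.
apply: (iffP allP) => [st|st n].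
  by apply/setP=> d; rewrite !inE; apply/eqP/st; rewrite mem_iota /=.
rewrite mem_iota /= => n5; move/setP/(_ (Ordinal n5)): st.
by rewrite !inE => /= ->.
Qed.

Lemma example_childE (d e : 'I_5) :
  child example_history d e = (val d == 0) && (val e != 0).
Proof. by case: d e => [[|[|[|[|[|d]]]]] d5] [[|[|[|[|[|e]]]]] e5]. Qed.

Lemma example_forest : is_forest (child example_history).
Proof.
split=> [v vv|v v' v''].
  (* Every child has a larger number than its parent, so a cycle would give [v < v]. *)
  suff: forall d e, clos_trans 'I_5 (child example_history) d e -> val d < val e.
    by move/(_ v v vv); rewrite ltnn.
  move=> d e; elim=> {d e vv} [d e|d e f _ de _ ef]; last exact: ltn_trans ef.
  by rewrite example_childE => /andP[/eqP ->]; rewrite lt0n.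
rewrite !example_childE => /andP[/eqP v0 _] /andP[/eqP w0 _].
by apply: val_inj; rewrite v0 w0.
Qed.

(** Choosing one document from each two-element session covers all the active sets that occur in the
    example. *)
Lemma example_navigation (a b : nat) :
  a \in [:: 1; 3] -> b \in [:: 2; 4] ->
  navigation_history (with_active example_history (docs [:: 0; a; b])).
Proof.
move=> ha hb; split; first exact: example_forest.
- split=> [d|d e|d e f|d e] //=.
  + by rewrite -eqn_leq => /eqP/val_inj.
  + exact: leq_trans.
  + exact: leq_total.
- split=> [d|d e|d e f].
  + by case: d => [[|[|[|[|[|d]]]]] d5].
  + by case: d e => [[|[|[|[|[|d]]]]] d5] [[|[|[|[|[|e]]]]] e5].
  + by case: d e f => [[|[|[|[|[|d]]]]] d5] [[|[|[|[|[|e]]]]] e5]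
                      [[|[|[|[|[|f]]]]] f5].
- split=> [d|d e e'|d e].
  + have a5 : a < 5 by move: ha; rewrite !inE => /orP[] /eqP ->.
    have b5 : b < 5 by move: hb; rewrite !inE => /orP[] /eqP ->.
    (* Parity separates the sessions {1, 3} and {2, 4}. *)
    exists (if val d == 0 then ord0 else if odd d then Ordinal a5 else Ordinal b5).
    move: a5 b5; move: ha hb; rewrite !inE.
    move=> /orP[] /eqP -> /orP[] /eqP -> a5 b5;
      case: d => [[|[|[|[|[|d]]]]] d5] //=; split; rewrite ?inE //= => -[e e5] [];
      rewrite inE /=; move: e e5 => [|[|[|[|[|e]]]]] e5 //= _ _; exact: val_inj.
  + by case: d e e' => [[|[|[|[|[|d]]]]] d5] [[|[|[|[|[|e]]]]] e5]
                      [[|[|[|[|[|f]]]]] f5].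
  + by rewrite [child _ _ _]example_childE => /andP[/= /eqP ->].
Qed.

Lemma example_fully_active (s : seq nat) :
  0 \in s -> fully_active (with_active example_history (docs s)) = docs s.
Proof.
set H := with_active _ _ => s0.
have rootE d : active_root H d = (d == ord0).
  apply/andP/eqP => [[_ /forallP /(_ ord0)]|->].
    by rewrite [child _ _ _]example_childE /= negbK => /eqP d0; apply: val_inj.
  split; first by rewrite inE.
  by apply/forallP=> p; rewrite [child _ _ _]example_childE andbF.
apply/setP=> d; rewrite inE; apply/existsP/idP => [[r /andP[]]|sd].
  case/andP=> + _; rewrite rootE => /eqP -> /connectP[p].
  (* The last edge of a nonempty path ends in an active document. *)
  case/lastP: p => [_ ->|p x]; first by rewrite inE.
  by rewrite rcons_path last_rcons => /andP[_ /andP[_ ?]] ->.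
exists ord0; apply/andP; split.
  by apply/andP; split; [rewrite rootE | apply/forallP=> r; rewrite rootE implybb].
have [->|d0] := eqVneq d ord0; first exact: connect0.
by apply: connect1; apply/andP; split; first rewrite [child _ _ _]example_childE.
Qed.

Definition same_session (d e : nat) : bool :=
  has (fun C => (d \in C) && (e \in C)) [:: [:: 0]; [:: 1; 3]; [:: 2; 4]].

(** A counterpart of [future_list] on plain numbers, which evaluates without enumerating finite
    sets. *)
Definition future_docs (s : seq nat) : seq nat :=
  [seq e <- iota 0 5
  | has (fun d => [&& d \in s, same_session d e & d < e]) (iota 0 5)].

Lemma example_session_before (d e : 'I_5) :
  session_before example_history d e = same_session d e && (d < e).
Proof. by rewrite ltn_neqAle [_ && (_ <= _)]andbC. Qed.

Lemma example_future_list (s : seq nat) :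
  0 \in s ->
  map val (future_list (with_active example_history (docs s)))
  = future_docs s.
Proof.
move=> s0; rewrite /future_docs /future_list -sort_map; set P := fun e => has _ _.
(* A filtered [iota] is already increasing, so sorting leaves it unchanged. *)
rewrite (_ : map _ _ = [seq e <- iota 0 5 | P e]).
  exact/(sorted_sort leq_trans)/(sorted_filter leq_trans)/iota_sorted.
rewrite -val_enum_ord filter_map enumT; congr map; apply: eq_filter => e.
rewrite inE /= inE example_fully_active //; apply/existsP/hasP => [[d /andP[]]|[d]].
  rewrite inE [session_before _ _ _]example_session_before => sd de.
  by exists (val d); [rewrite mem_iota /= | apply/andP].
rewrite mem_iota => /= d5 /andP[sd de]; exists (Ordinal d5).
by rewrite inE [session_before _ _ _]example_session_before; apply/andP.
Qed.

Lemma example_traverse_to (s t : seq nat) (d : 'I_5) :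
  all (fun e => (e \in t) ==
              (e \in s) && ~~ same_session d e || (e == d :> nat))
      (iota 0 5) ->
  traverse_to (with_active example_history (docs s)) d =
  with_active example_history (docs t).
Proof.
move=> /allP st; congr History; apply/setP=> e; rewrite !inE.
by apply/esym/eqP; rewrite (eqP (st (val e) _)) // mem_iota /=.
Qed.

(** Turns a forward traversal into checks on lists of numbers; for concrete [s], [t], [n] and [d]
    all of them hold by evaluation. *)
Lemma example_traverses_by (s t : seq nat) (n d : nat) :
  0 \in s ->
  onth (future_docs s) n = Some d ->
  all (fun e => (e \in t) ==
              (e \in s) && ~~ same_session d e || (e == d :> nat))
      (iota 0 5) ->
  traverses_by (with_active example_history (docs s)) n.+1
               (with_active example_history (docs t)).
Proof.
move=> s0; rewrite -example_future_list // onth_map.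
case fn: (onth _ n) => [f|] //= [<-] st.
by exists f => //; apply: example_traverse_to.
Qed.

Theorem mainTheorem2 :
  let H := example_history in
  let H023 := with_active H (docs [:: 0; 2; 3]) in
  let H034 := with_active H (docs [:: 0; 3; 4]) in
  let H014 := with_active H (docs [:: 0; 1; 4]) in
  [/\ navigation_history H, navigation_history H023,
      navigation_history H034 & navigation_history H014] /\
  [/\ traverses_by H 1%Z H023,
      traverses_by H023 1%Z H034,
      traverses_by H 2%Z H014
    & H014 <> H034] /\
  ~ fundamental_property H.
Proof.
move=> H H023 H034 H014.
(* [example_navigation] expects the representative of {1, 3} before that of {2, 4}. *)
have docsC : docs [:: 0; 2; 3] = docs [:: 0; 3; 2] by apply/docs_eqP.
have navH023 : navigation_history H023.
  by rewrite /H023 docsC; apply: example_navigation.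
have navH034 : navigation_history H034 by apply: example_navigation.
have H_1 : traverses_by H 1%Z H023.
  exact: (@example_traverses_by [:: 0; 1; 2] [:: 0; 2; 3] 0 3).
have H023_1 : traverses_by H023 1%Z H034 by apply: (@example_traverses_by _ _ 0 4).
(* Going straight to 4 replaces only 2, so 1 stays active. *)
have H_2 : traverses_by H 2%Z H014.
  exact: (@example_traverses_by [:: 0; 1; 2] [:: 0; 1; 4] 1 4).
have neq : H014 <> H034 by move/(congr1 (@active _))/docs_eqP.
split; first by split=> //; apply: example_navigation.
split=> // /(_ 1%Z 1%Z H023 H034 navH023 navH034 H_1 H023_1) H_11.
(* The sum [1 + 1] evaluates to 2, so [H_2] and [H_11] describe the same traversal with different
   results. *)
exact: neq (traverses_by_functional _ _ _ _ _ H_2 H_11).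
Qed.
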